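(* For any $\alpha\in\mathbf{C}$, the Novikov product $L_n\circ L_m:=(\alpha+m)L_{n+m}$ and the associative product $L_n\cdot L_m:=L_{n+m}$ define a $\mathbf{W}$-compatible Novikov--Poisson structure on the vector space $\mathbf{W}=\langle L_n\mid n\in\mathbf{Z}\rangle$.
   Context: All algebras are over $\mathbf{C}$; $\mathbf{W}$ is the vector space with basis $\{L_n\mid n\in\mathbf{Z}\}$ underlying the Witt algebra. A Novikov product is a bilinear product $\circ$ that is left-symmetric, $(x\circ y)\circ z-x\circ(y\circ z)=(y\circ x)\circ z-y\circ(x\circ z)$, and satisfies $(x\circ y)\circ z=(x\circ z)\circ y$. A Novikov--Poisson structure consists of a Novikov product $\circ$ and a commutative associative product $\cdot$ satisfying, for all $x,y,z$: $(x\cdot y)\circ z=x\cdot(y\circ z)$ and $(x\circ y)\cdot z-x\circ(y\cdot z)=(y\circ x)\cdot z-y\circ(x\cdot z)$. It is $\mathbf{W}$-compatible if the commutator $x\circ y-y\circ x$ is the Witt algebra Lie bracket, here with the sign normalization $L_n\circ L_m-L_m\circ L_n=(m-n)L_{n+m}$. *)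

(* Defs.v *)
From mathcomp Require Import all_boot all_order all_algebra.
From mathcomp Require Import finmap reals complex monalg.

Set Implicit Arguments.
Unset Strict Implicit.
Unset Printing Implicit Defensive.

Import GRing.Theory.
Local Open Scope ring_scope.

Section NovikovPoisson.
Variables (F : comNzRingType) (A : lmodType F).
Implicit Types op circ dot : A -> A -> A.

Definition is_bilinear op : Prop := bilinear_for *:%R *:%R op.

Definition left_symmetric op : Prop :=
  forall x y z,
    op (op x y) z - op x (op y z) = op (op y x) z - op y (op x z).

Record is_novikov circ : Prop := IsNovikov {
  novikov_bilinear : is_bilinear circ;
  novikov_left_symmetric : left_symmetric circ;
  novikov_right_comm : right_commutative circ
}.

Record is_novikov_poisson circ dot : Prop := IsNovikovPoisson {
  np_novikov : is_novikov circ;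
  np_dot_bilinear : is_bilinear dot;
  np_dot_comm : commutative dot;
  np_dot_assoc : associative dot;
  np_dot_circ : forall x y z, circ (dot x y) z = dot x (circ y z);
  np_circ_dot : forall x y z,
    dot (circ x y) z - circ x (dot y z) = dot (circ y x) z - circ y (dot x z)
}.
End NovikovPoisson.

Section Witt.
Variable F : comNzRingType.

(* The free F-module on the basis (L_n), n in Z; wittL n is L_n. *)
Local Notation W := {malg F[int]}.

Definition wittL (n : int) : W := << n >>.

(* The bilinear map W x W -> W with prescribed values f n m on the basis. *)
Definition bilin_ext (f : int -> int -> W) (x y : W) : W :=
  \sum_(n <- msupp x) \sum_(m <- msupp y) (x@_n * y@_m) *: f n m.

Lemma bilin_extE f n m : bilin_ext f (wittL n) (wittL m) = f n m.
Proof.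
rewrite /bilin_ext /wittL !msuppU oner_eq0 !big_seq_fset1 !mcoeffUU.
by rewrite mulr1 scale1r.
Qed.

Definition witt_circ (alpha : F) : W -> W -> W :=
  bilin_ext (fun n m => (alpha + m%:~R) *: wittL (n + m)).

Definition witt_dot : W -> W -> W := bilin_ext (fun n m => wittL (n + m)).

Definition witt_bracket : W -> W -> W :=
  bilin_ext (fun n m => (m - n)%:~R *: wittL (n + m)).

Definition witt_compatible (circ : W -> W -> W) : Prop :=
  forall x y, circ x y - circ y x = witt_bracket x y.
End Witt.

(* Main.v *)
Require Import Defs.
From mathcomp Require Import all_boot all_order all_algebra.
From mathcomp Require Import finmap reals complex monalg.

(** The given product is an instance of Gelfand's construction.  Under
    [L_n . L_m = L_(n+m)] the space is the algebra of Laurent polynomials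
    ([L_n] being [t^n]), on which [D = t d/dt : L_m |-> m L_m] is a derivation,
    and [L_n o L_m = (alpha + m) L_(n+m)] says exactly that
    [x o y = x . E y] with [E y = D y + alpha y].

    For any commutative associative product and any derivation [D], such an
    [o] is a Novikov-Poisson product ([is_novikov_poisson_twisted_derivation]).
    Right commutativity and [(x . y) o z = x . (y o z)] are instances of
    commutativity and associativity.  The two axioms comparing associators hold
    because the Leibniz rule gives [E (y . z) = y . E z + D y . z], so
    [(x o y) . z - x o (y . z) = alpha (x . y) . z - (x . y) . E z], which is
    symmetric in [x] and [y]; replacing [z] by [E z] turns this into left
    symmetry.

    What remains concerns only maps on the free module spanned by the [L_n]:
    all of them are linear in each argument ([bilin_ext_bilinear]), so that
    identities between them may be checked on the basis
    ([linear_eq_on_wittL], [bilinear_eq_on_wittL]), where they become additions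
    of exponents. *)

Set Implicit Arguments.
Unset Strict Implicit.
Unset Printing Implicit Defensive.

Import GRing.Theory.
Local Open Scope ring_scope.

Lemma linear_fun0 (F : nzRingType) (U V : lmodType F) (f : U -> V) :
  linear f -> f 0 = 0.
Proof.
by move=> f_lin; have:= f_lin (-1) 0 0; rewrite scaler0 addr0 scaleN1r addNr.
Qed.

(** * Gelfand's construction *)

Section GelfandConstruction.
Variables (F : comNzRingType) (A : lmodType F).
Variables (dot circ : A -> A -> A) (D : A -> A) (a : F).
Hypothesis dot_bilinear : is_bilinear dot.
Hypothesis dotC : commutative dot.
Hypothesis dotA : associative dot.
Hypothesis D_linear : linear D.
Hypothesis D_leibniz : forall x y, D (dot x y) = dot (D x) y + dot x (D y).
Hypothesis circE : forall x y, circ x y = dot x (D y + a *: y).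

Let dot_linl c x y z : dot (c *: x + y) z = c *: dot x z + dot y z.
Proof. exact: (dot_bilinear.1 z). Qed.

Let dot_linr c x y z : dot z (c *: x + y) = c *: dot z x + dot z y.
Proof. exact: (dot_bilinear.2 z). Qed.

Let dotDr x y z : dot z (x + y) = dot z x + dot z y.
Proof. by have:= dot_linr 1 x y z; rewrite !scale1r. Qed.

Let dot0r z : dot z 0 = 0.
Proof. exact: linear_fun0 (dot_bilinear.2 z). Qed.

Let dotZr c x z : dot z (c *: x) = c *: dot z x.
Proof. by have:= dot_linr c x 0 z; rewrite dot0r !addr0. Qed.

Lemma twisted_derivation_bilinear : is_bilinear circ.
Proof.
split=> [z|z] c x y; rewrite !circE ?dot_linl // D_linear -dot_linr.
by congr dot; rewrite !scalerDr !scalerA (mulrC a) addrACA.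
Qed.

(** By commutativity the right-hand side is symmetric in [x] and [y]: expanding
    [D (dot y z)] by the Leibniz rule, the term [dot x (dot (D y) z)], the only
    one that treats [x] and [y] differently, occurs with both signs. *)
Lemma twisted_derivation_assoc x y z :
  dot (circ x y) z - circ x (dot y z) =
  a *: dot (dot x y) z - dot (dot x y) (D z + a *: z).
Proof.
rewrite !circE D_leibniz -[dot (dot x _) z]dotA (dotC (_ + _) z).
rewrite !dotDr !dotZr (dotC z (D y)) (dotC z y) !dotA.
by rewrite -[X in _ - X = _]addrA [X in X - _ = _]addrC addrKA.
Qed.

Lemma is_novikov_poisson_twisted_derivation : is_novikov_poisson circ dot.
Proof.
have assoc_sym x y z :
    dot (circ x y) z - circ x (dot y z) = dot (circ y x) z - circ y (dot x z).
  by rewrite !twisted_derivation_assoc (dotC x y).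
split=> //; last by move=> x y z; rewrite !circE dotA.
split; first exact: twisted_derivation_bilinear.
(* Since [circ _ z] is multiplication by [D z + a *: z], left symmetry is
   [assoc_sym] at that element. *)
- move=> x y z; rewrite [circ (circ _ _) _]circE [circ y z]circE.
  by rewrite assoc_sym -!circE.
- by move=> x y z; rewrite !circE -!dotA (dotC (D y + _)).
Qed.

End GelfandConstruction.

(** * Linear and bilinear maps on the span of the basis *)

Section WittBasis.
Variable F : comNzRingType.
Local Notation W := {malg F[int]}.
Local Notation L := (wittL F).

Definition lin_ext (h : int -> W) (x : W) : W :=
  \sum_(n <- msupp x) x@_n *: h n.

(** The summation range may be any set containing the support, so that
    supports of several elements can be brought to a common range. *)
Lemma lin_extEw h (x : W) (d : {fset int}) :
  (msupp x `<=` d)%fset -> lin_ext h x = \sum_(n <- d) x@_n *: h n.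
Proof.
move=> le_xd; apply: big_fset_incl le_xd _ => n _ /mcoeff_outdom ->.
by rewrite scale0r.
Qed.

Lemma lin_ext_linear h : linear (lin_ext h).
Proof.
move=> c x y; set d := (msupp (c *: x + y) `|` (msupp x `|` msupp y))%fset.
have le_l : (msupp (c *: x + y) `<=` d)%fset by apply: fsubsetUl.
have le_x : (msupp x `<=` d)%fset.
  by apply: fsubset_trans (fsubsetUr _ _); apply: fsubsetUl.
have le_y : (msupp y `<=` d)%fset.
  by apply: fsubset_trans (fsubsetUr _ _); apply: fsubsetUr.
rewrite (lin_extEw h le_l) (lin_extEw h le_x) (lin_extEw h le_y).
rewrite scaler_sumr -big_split; apply: eq_bigr => n _ /=.
by rewrite mcoeffD mcoeffZ scalerDl scalerA.
Qed.

Lemma lin_ext_wittL h n : lin_ext h (L n) = h n.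
Proof.
by rewrite /lin_ext /wittL msuppU oner_eq0 big_seq_fset1 mcoeffUU scale1r.
Qed.

Lemma bilin_ext_lin_ext f (x y : W) :
  bilin_ext f x y = lin_ext (fun n => lin_ext (f n) y) x.
Proof.
apply: eq_bigr => n _; rewrite scaler_sumr.
by apply: eq_bigr => m _; rewrite scalerA.
Qed.

Lemma bilin_ext_bilinear f : is_bilinear (@bilin_ext F f).
Proof.
split=> z c x y; rewrite !bilin_ext_lin_ext; first exact: lin_ext_linear.
rewrite !(lin_extEw _ (fsubset_refl (msupp z))) /=.
rewrite scaler_sumr -big_split; apply: eq_bigr => n _ /=.
by rewrite lin_ext_linear scalerDr !scalerA (mulrC c).
Qed.

Lemma linear_eq_on_wittL (f g : W -> W) :
    linear f -> linear g -> (forall n, f (L n) = g (L n)) ->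
  f =1 g.
Proof.
move=> f_lin g_lin fg x; rewrite [x]monalgE.
elim/big_rec: _ => [|n y _ IHy].
  by rewrite (linear_fun0 f_lin) (linear_fun0 g_lin).
suff ->: << x@_n *g n >> = x@_n *: L n :> W by rewrite f_lin g_lin fg IHy.
by apply/malgP=> k; rewrite mcoeffZ !mcoeffU mulrnAr mulr1.
Qed.

Lemma bilinear_eq_on_wittL (f g : W -> W -> W) :
    is_bilinear f -> is_bilinear g ->
    (forall n m, f (L n) (L m) = g (L n) (L m)) ->
  forall x y, f x y = g x y.
Proof.
move=> f_bil g_bil fg x y.
apply: (linear_eq_on_wittL (f_bil.1 y) (g_bil.1 y)) => n.
exact: (linear_eq_on_wittL (f_bil.2 (L n)) (g_bil.2 (L n)) (fg n) y).
Qed.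

(** * The Laurent polynomial algebra and its derivation *)

Local Notation dot := (@witt_dot F).

Let dot_linl c (x y z : W) : dot (c *: x + y) z = c *: dot x z + dot y z.
Proof. exact: (bilin_ext_bilinear _).1. Qed.

Let dot_linr c (x y z : W) : dot z (c *: x + y) = c *: dot z x + dot z y.
Proof. exact: (bilin_ext_bilinear _).2. Qed.

Let dotL n m : dot (L n) (L m) = L (n + m).
Proof. exact: bilin_extE. Qed.

Lemma witt_dotC : commutative dot.
Proof.
apply: bilinear_eq_on_wittL => [||n m]; first exact: bilin_ext_bilinear.
- by split=> z c x y; rewrite ?dot_linl ?dot_linr.
- by rewrite !dotL addrC.
Qed.

Lemma witt_dotA : associative dot.
Proof.
move=> x y z; move: x y.
apply: bilinear_eq_on_wittL => [||n m].
- by split=> t c x y; rewrite ?(dot_linl, dot_linr).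
- by split=> t c x y; rewrite ?(dot_linl, dot_linr).
move: z; apply: linear_eq_on_wittL => [c x y|c x y|k].
- by rewrite !dot_linr.
- by rewrite !dot_linr.
- by rewrite !dotL addrA.
Qed.

(** The Euler derivation [t d/dt], with [L m] read as [t^m]. *)
Definition witt_degree : W -> W := lin_ext (fun m => m%:~R *: L m).

Let degree_lin : linear witt_degree.
Proof. exact: lin_ext_linear. Qed.

Let degreeL n : witt_degree (L n) = n%:~R *: L n.
Proof. exact: lin_ext_wittL. Qed.

Let dotZL c n m : dot (c *: L n) (L m) = c *: L (n + m).
Proof.
have dot0l := linear_fun0 ((bilin_ext_bilinear _).1 (L m)).
by rewrite -[c *: L n]addr0 dot_linl [dot 0 _]dot0l addr0 dotL.
Qed.

Lemma witt_degree_leibniz x y :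
  witt_degree (dot x y) = dot (witt_degree x) y + dot x (witt_degree y).
Proof.
move: x y; apply: bilinear_eq_on_wittL => [||n m].
- by split=> z c x y; rewrite ?dot_linl ?dot_linr degree_lin.
- split=> z c x y; rewrite degree_lin !(dot_linl, dot_linr) /= scalerDr;
  exact: addrACA.
- rewrite dotL !degreeL [dot (L n) _]witt_dotC !dotZL (addrC m) -scalerDl.
  by rewrite -intrD.
Qed.

Lemma witt_circE alpha x y :
  witt_circ alpha x y = dot x (witt_degree y + alpha *: y).
Proof.
move: x y; apply: bilinear_eq_on_wittL => [||n m].
- exact: bilin_ext_bilinear.
- split=> z c x y; first exact: dot_linl.
  rewrite degree_lin -dot_linr; congr dot.
  by rewrite !scalerDr !scalerA (mulrC alpha) addrACA.
- rewrite /witt_circ bilin_extE degreeL -scalerDl witt_dotC dotZL.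
  by rewrite addrC [m + n]addrC.
Qed.

Lemma is_novikov_poisson_witt (alpha : F) :
  is_novikov_poisson (witt_circ alpha) dot.
Proof.
apply: is_novikov_poisson_twisted_derivation (witt_circE alpha).
- exact: bilin_ext_bilinear.
- exact: witt_dotC.
- exact: witt_dotA.
- exact: degree_lin.
- exact: witt_degree_leibniz.
Qed.

Lemma witt_compatible_circ (alpha : F) : witt_compatible (witt_circ alpha).
Proof.
have [circ_l circ_r] : is_bilinear (witt_circ alpha).
  exact: bilin_ext_bilinear.
apply: bilinear_eq_on_wittL => [||n m].
- by split=> z c x y; rewrite circ_l circ_r /= scalerBr opprD addrACA.
- exact: bilin_ext_bilinear.
- rewrite /witt_circ /witt_bracket !bilin_extE [m + n]addrC -scalerBl.
  by rewrite (addrC alpha) addrKA intrB.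
Qed.

End WittBasis.

Theorem theorem5p1 (R : realType) (alpha : R[i]) :
  is_novikov_poisson (witt_circ alpha) (@witt_dot _) /\
  witt_compatible (witt_circ alpha).
Proof.
split; [exact: is_novikov_poisson_witt | exact: witt_compatible_circ].
Qed.
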